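(* The following identity holds for all real $x_1,x_2,x_3,x_4$: \begin{align*} 315\Big(\sum_{i=1}^4(2x_i)^2\Big)^4={}&60\sum_{8}(x_1\pm x_2\pm x_3\pm x_4)^8+60\sum_{4}(2x_i)^8+6\sum_{12}(2x_i\pm2x_j)^8\\ &+\sum_{16}(2x_i\pm2x_j\pm2x_k)^8+\sum_{32}(3x_i\pm x_j\pm x_k\pm x_l)^8 . \end{align*}
   Context: The subscript on each sum is its number of terms: $\sum_8$ runs over all $2^3$ choices of signs; $\sum_4$ runs over $i\in\{1,2,3,4\}$; $\sum_{12}$ runs over all pairs $i<j$ in $\{1,2,3,4\}$ and both signs; $\sum_{16}$ runs over all triples $i<j<k$ in $\{1,2,3,4\}$ and all $2^2$ choices of signs; $\sum_{32}$ runs over all $i\in\{1,2,3,4\}$ with $\{j,k,l\}=\{1,2,3,4\}\setminus\{i\}$, $j<k<l$, and all $2^3$ choices of signs. *)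

(* Defs.v *)
From mathcomp Require Export all_boot all_order all_algebra.
From mathcomp Require Export reals.
Set Implicit Arguments.
Unset Strict Implicit.
Unset Printing Implicit Defensive.
Export GRing.Theory Num.Theory.

(* Indices are shifted by one: x 0, x 1, x 2, x 3 (with x : 'I_4 -> R) stand
   for x_1, ..., x_4; the numerals 0, ..., 3 : 'I_4 have the values 0, ..., 3.
   A sign is a boolean s acting as (-1) ^+ s, so that a sum over s : bool is a
   sum over both signs. *)

(* Main.v *)
Require Import Defs.
From mathcomp Require Import all_boot all_order all_algebra.
From mathcomp Require Import reals.
From mathcomp Require Import ring.
Local Open Scope ring_scope.

(** Both sides are polynomials of degree 8 in four variables with integer coefficients, so it
    suffices to compare coefficients. Summing over signs cancels every monomial with an odd
    exponent, and the weights make the rest agree. The only work is to turn the indexed sums into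
    explicit ones: [sum_pairs_ord4], [sum_triples_ord4] and [sum_complements_ord4] list the
    admissible indices, and [ring] decides what is left. *)

Lemma big_ord4_cond (V : nmodType) (P : pred 'I_4) (F : 'I_4 -> V) :
  \sum_(i < 4 | P i) F i =
    (if P 0 then F 0 else 0) + (if P 1 then F 1 else 0)
  + (if P 2 then F 2 else 0) + (if P 3 then F 3 else 0).
Proof.
rewrite big_mkcond !big_ord_recr big_ord0 /= add0r.
(* [big_ord_recr] leaves indices built from [widen_ord] and [ord_max]; they agree with the numerals
   in value, whence [val_inj]. *)
by congr (_ + _ + _ + _); congr (if P _ then F _ else _); apply: val_inj.
Qed.

Lemma big_ord4 (V : nmodType) (F : 'I_4 -> V) :
  \sum_(i < 4) F i = F 0 + F 1 + F 2 + F 3.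
Proof. exact: big_ord4_cond. Qed.

Lemma sum_pairs_ord4 (V : nmodType) (F : 'I_4 -> 'I_4 -> V) :
  \sum_(i < 4) \sum_(j < 4 | (i < j)%N) F i j =
  F 0 1 + F 0 2 + F 0 3 + F 1 2 + F 1 3 + F 2 3.
Proof. by rewrite big_ord4 !big_ord4_cond /= !(add0r, addr0) !addrA. Qed.

Lemma sum_triples_ord4 (V : nmodType) (F : 'I_4 -> 'I_4 -> 'I_4 -> V) :
  \sum_(i < 4) \sum_(j < 4 | (i < j)%N) \sum_(k < 4 | (j < k)%N) F i j k =
  F 0 1 2 + F 0 1 3 + F 0 2 3 + F 1 2 3.
Proof. by rewrite sum_pairs_ord4 !big_ord4_cond /= !(add0r, addr0). Qed.

(** The ordering makes [j], [k], [l] distinct, so both sets have three elements and equality reduces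
    to inclusion. The resulting boolean test computes on numerals, unlike equality of finite
    sets. *)
Lemma set3_eq_setC1_ord4 (i j k l : 'I_4) : (j < k < l)%N ->
  ([set j; k; l] == [set~ i]) = [&& i != j, i != k & i != l].
Proof.
move=> /andP[ltjk ltkl].
have card_jkl : #|[set j; k; l]| = 3%N.
  rewrite setUC cardsU1 cards2 !inE !negb_or -!val_eqE /=.
  by rewrite (gtn_eqF ltkl) (gtn_eqF (ltn_trans ltjk ltkl)) (ltn_eqF ltjk).
rewrite eqEcard card_jkl cardsC1 card_ord leqnn andbT.
by rewrite !subUset !sub1set !inE -andbA !(eq_sym i).
Qed.

Lemma sum_complements_ord4 (V : nmodType)
    (F : 'I_4 -> 'I_4 -> 'I_4 -> 'I_4 -> V) :
  \sum_(i < 4) \sum_(j < 4) \sum_(k < 4)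
    \sum_(l < 4 | (j < k < l)%N && ([set j; k; l] == [set~ i])) F i j k l =
  F 0 1 2 3 + F 1 0 2 3 + F 2 0 1 3 + F 3 0 1 2.
Proof.
(* [andb_id2l] lets the second conjunct be rewritten under the ordering hypothesis given by the
   first. *)
under eq_bigr => i _ do under eq_bigr => j _ do under eq_bigr => k _ do
  under eq_bigl => l do rewrite (andb_id2l (@set3_eq_setC1_ord4 i j k l)).
by rewrite !big_ord4 !big_ord4_cond /= !(add0r, addr0).
Qed.

Theorem mainTheorem9 (R : realType) (x : 'I_4 -> R) :
  315 * (\sum_(i < 4) (2 * x i) ^+ 2) ^+ 4 =
    60 * (\sum_(a : bool) \sum_(b : bool) \sum_(c : bool)
            (x 0 + (-1) ^+ a * x 1 + (-1) ^+ b * x 2 + (-1) ^+ c * x 3) ^+ 8)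
  + 60 * (\sum_(i < 4) (2 * x i) ^+ 8)
  + 6 * (\sum_(i < 4) \sum_(j < 4 | (i < j)%N) \sum_(a : bool)
           (2 * x i + (-1) ^+ a * (2 * x j)) ^+ 8)
  + \sum_(i < 4) \sum_(j < 4 | (i < j)%N) \sum_(k < 4 | (j < k)%N)
      \sum_(a : bool) \sum_(b : bool)
        (2 * x i + (-1) ^+ a * (2 * x j) + (-1) ^+ b * (2 * x k)) ^+ 8
  + \sum_(i < 4) \sum_(j < 4) \sum_(k < 4)
      \sum_(l < 4 | (j < k < l)%N && ([set j; k; l] == [set~ i]))
        \sum_(a : bool) \sum_(b : bool) \sum_(c : bool)
          (3 * x i + (-1) ^+ a * x j + (-1) ^+ b * x k + (-1) ^+ c * x l) ^+ 8.
Proof.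
rewrite sum_pairs_ord4 sum_triples_ord4 sum_complements_ord4 !big_ord4.
(* Signs become literal [1] and [-1], leaving a ring identity in the atoms [x 0], ..., [x 3]. *)
rewrite !big_bool /= !expr0 !expr1.
ring.
Qed.
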